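(* Let $R$ be a totally ordered commutative ring with $1$ and let $X$ be a Stone space. Then $C(X,R_{\mathrm{disc}})=FC(X,R)$ (as sets of functions $X\to R$).
   Context: A totally ordered commutative ring is a commutative ring with a total order such that $a\le b$ implies $a+c\le b+c$ for each $c$, and $0\le a,b$ implies $0\le ab$. A Stone space is a zero-dimensional compact Hausdorff space. $C(X,R_{\mathrm{disc}})$ is the set of continuous functions from $X$ to $R$ with the discrete topology. $C(X,R)$ is the set of continuous functions from $X$ to $R$ with the interval (order) topology of the total order, and $FC(X,R)$ is the set of those functions in $C(X,R)$ that take only finitely many values. *)

(* Defs.v *)
From HB Require Import structures.
From mathcomp Require Import all_boot all_order all_algebra.
From mathcomp Require Import all_classical.
From mathcomp Require Import topology.

Set Implicit Arguments.
Unset Strict Implicit.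
Unset Printing Implicit Defensive.

Import Order.TTheory GRing.Theory.
Local Open Scope classical_set_scope.
Local Open Scope ring_scope.

HB.mixin Record ComPzRing_isTotallyOrdered R of GRing.ComPzRing R := {
  ring_le : rel R;
  ring_le_refl : reflexive ring_le;
  ring_le_anti : antisymmetric ring_le;
  ring_le_trans : transitive ring_le;
  ring_le_total : total ring_le;
  ring_le_addr : forall a b c : R, ring_le a b -> ring_le (a + c) (b + c);
  ring_le_mul_ge0 : forall a b : R,
    ring_le 0 a -> ring_le 0 b -> ring_le 0 (a * b)
}.

(* Neither 0 <> 1 nor the absence of zero divisors is assumed, so this is more
   general than realDomainType.  HB accepts no new structure joining the ring and
   order hierarchies once realDomainType exists, hence the separate relation
   ring_le and the alias ring_order that carries it as an orderType. *)
#[short(type="totallyOrderedComRingType")]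
HB.structure Definition TotallyOrderedComRing :=
  { R of GRing.ComPzRing R & ComPzRing_isTotallyOrdered R }.

Definition ring_order (R : Type) : Type := R.

HB.instance Definition _ (R : totallyOrderedComRingType) :=
  Choice.copy (ring_order R) R.
HB.instance Definition _ (R : totallyOrderedComRingType) :=
  Order.Le_isPOrder.Build Order.default_display (ring_order R)
    (@ring_le_refl R) (@ring_le_anti R) (@ring_le_trans R).
HB.instance Definition _ (R : totallyOrderedComRingType) :=
  Order.POrder_isTotal.Build Order.default_display (ring_order R)
    (@ring_le_total R).

(* The library's zero_dimensional only asks that distinct points be separated
   by a clopen set; here zero-dimensionality is the existence of a base of
   clopen sets. *)
Definition has_clopen_basis (X : topologicalType) : Prop :=
  exists2 B : set (set X), B `<=` clopen & basis B.

Definition stone_space (X : topologicalType) : Prop :=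
  [/\ has_clopen_basis X, compact [set: X] & hausdorff_space X].

(* The three sets below consist of functions X -> R: discrete_topology,
   order_topology and ring_order are aliases of the identity on types. *)
Definition C_disc (X : topologicalType) (R : totallyOrderedComRingType) :
    set (X -> R) :=
  [set f | continuous (f : X -> discrete_topology R)].
Arguments C_disc : clear implicits.

Definition C_ord (X : topologicalType) (R : totallyOrderedComRingType) :
    set (X -> R) :=
  [set f | continuous (f : X -> order_topology (ring_order R))].
Arguments C_ord : clear implicits.

Definition FC (X : topologicalType) (R : totallyOrderedComRingType) :
    set (X -> R) :=
  C_ord X R `&` [set f | finite_set (range f)].
Arguments FC : clear implicits.

(* Main.v *)
Require Import Defs.
From HB Require Import structures.
From mathcomp Require Import all_boot all_order all_algebra.
From mathcomp Require Import all_classical.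
From mathcomp Require Import topology.

Local Open Scope classical_set_scope.

(** The discrete topology refines the order topology, and a continuous image of a compact space in a
    discrete one is compact, hence finite. Conversely, the order topology is Hausdorff, so finite
    sets are closed; for [f] of finite range this makes the preimage of every set closed, which is
    continuity into the discrete space. *)

Lemma compact_discrete_finite (T : discreteTopologicalType) (A : set T) :
  compact A -> finite_set A.
Proof.
have [->|/set0P[x _]] := eqVneq A set0; first by [].
(* [compact_cover] is stated for pointed spaces only. *)
pose pT : ptopologicalType := HB.pack (T : Type) T (isPointed.Build T x).
rewrite (@compact_cover pT) => Acov.
(* In the open cover of [A] by its singletons, a finite subcover is indexed by a finite set [D]
   containing [A]. *)
have [|y Ay|D _ AD] := Acov T A (fun y => [set y]).
- by move=> y _; exact: (@discrete_open T).
- by exists y.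
- apply: sub_finite_set (finite_fset D) => y /AD[z Dz /= ->].
  exact: Dz.
Qed.

Lemma continuous_discrete_finite_range (X : topologicalType)
    (T : discreteTopologicalType) (f : X -> T) :
  compact [set: X] -> continuous f -> finite_set (range f).
Proof.
move=> cX cf; apply: compact_discrete_finite; apply: continuous_compact => //.
exact: continuous_subspaceT.
Qed.

(** Replacing [A] by its trace on [range f] keeps the preimage and leaves a finite set, closed in a
    T1 space. *)
Lemma finite_range_preimage_closed (X T : topologicalType) (f : X -> T)
    (A : set T) :
  accessible_space T -> continuous f -> finite_set (range f) ->
  closed (f @^-1` A).
Proof.
move=> /accessible_finite_set_closed T1 /continuous_closedP cf finf.
have -> : f @^-1` A = f @^-1` (A `&` range f).
  by apply/seteqP; split=> [x Ax|x []//]; split=> //; exists x.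
apply: cf; apply: T1; apply: sub_finite_set finf; exact: subIsetr.
Qed.

Theorem proposition5p4 (R : totallyOrderedComRingType) (X : topologicalType)
    (hX : stone_space X) :
  C_disc X R = FC X R.
Proof.
have [_ cX _] := hX.
apply/seteqP; split=> [f cf|f [cf finf]].
- split; last exact: (continuous_discrete_finite_range _ _ _ cX cf).
  move/continuousP: cf => cf; apply/continuousP => A _.
  exact/cf/discrete_open.
(* [A] is arbitrary here, since every subset is closed in the discrete topology. *)
- apply/continuous_closedP => A _.
  apply: finite_range_preimage_closed cf finf.
  exact/hausdorff_accessible/order_hausdorff.
Qed.
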